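(* Let $n\ge 1$, let $r\in[n]=\{1,\dots,n\}$, and let $\lambda=1^{e_1}2^{e_2}\cdots$ be an integer partition of $n-1$ with length $\ell(\lambda)=\sum_{i\ge1}e_i$. Then there is a bijection between $\mathcal{T}^{(r)}_{n,\lambda}$ and $\Pi_{n,\lambda}\times\mathcal{S}^{(r)}_{n,\ell(\lambda)}$.
   Context: A rooted labeled tree on $[n]$ rooted at $r$ carries the global orientation, in which every edge is oriented towards the root; so the global indegree of a vertex is its number of children. The global indegree sequence of such a tree is the integer partition $1^{e_1}2^{e_2}\cdots$, where $e_i$ is the number of vertices of global indegree $i$ ($i\ge1$); it is a partition of $n-1$. $\mathcal{T}^{(r)}_{n,\lambda}$ is the set of labeled trees on $[n]$ rooted at $r$ whose global indegree sequence is $\lambda$. The type of a set partition is the integer partition $1^{e_1}2^{e_2}\cdots$, where $e_i$ is the number of blocks of size $i$. $\Pi_{n,\lambda}$ is the set of set partitions of a fixed $(n-1)$-element set whose type is $\lambda$. For $k\in[n]$, $\mathcal{S}^{(r)}_{n,k}$ is the set of $k$-permutations of $[n]$ with last entry $r$, i.e. sequences $(p_1,\dots,p_k)$ of $k$ distinct elements of $[n]$ with $p_k=r$. *)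

(* Defs.v *)
From mathcomp Require Import all_boot.
Set Implicit Arguments.
Unset Strict Implicit.
Unset Printing Implicit Defensive.

(* An integer partition is the weakly increasing list of its (positive) parts:
   1^{e_1} 2^{e_2} ... is e_1 ones, then e_2 twos, and so on. Thus
   e_i = count_mem i l, and the length of l is size l. *)
Definition is_intpart (m : nat) (l : seq nat) : bool :=
  [&& sorted leq l, all (fun i => 0 < i) l & sumn l == m].

Section Trees.
Variable n : nat.

(* The label set [n] is 'I_n, so labels run over 0, ..., n-1.
   A graph on [n] is given by its set of edges. *)
Implicit Types E : {set {set 'I_n}}.

Definition adj E : rel 'I_n := [rel x y | [set x; y] \in E].

Definition simple_graph E : bool := [forall e in E, #|e| == 2].

Definition connected_graph E : bool :=
  [forall x, forall y, connect (adj E) x y].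

(* The lengths of the candidate cycles are bounded to keep this boolean; the
   bound is harmless, see acyclicP. *)
Definition acyclic E : bool :=
  [forall k : 'I_n.+1, forall c : k.-tuple 'I_n,
     (2 < k) ==> ~~ ucycleb (adj E) c].

Definition is_tree E : bool :=
  [&& simple_graph E, connected_graph E & acyclic E].

(* The edge uv is oriented from u to v, i.e. towards r, when a simple path from
   u to r starts with the step from u to v (see towards_rootP), i.e. when v is
   joined to r without going through u. *)
Definition towards_root (r : 'I_n) E : rel 'I_n :=
  [rel u v | [&& adj E u v, u != v &
     connect [rel x y | [&& adj E x y, x != u & y != u]] v r]].

Definition global_indegree (r : 'I_n) E (v : 'I_n) : nat :=
  #|[set u | towards_root r E u v]|.

Definition global_indegree_seq (r : 'I_n) E : seq nat :=
  sort leq [seq d <- [seq global_indegree r E v | v : 'I_n] | 0 < d].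

Definition rooted_trees (r : 'I_n) (l : seq nat) : {set {set {set 'I_n}}} :=
  [set E | is_tree E && (global_indegree_seq r E == l)].

(* For k > 0 the value of [last r s] does not depend on the default r. For
   k = 0, the convention is that the empty sequence is accepted, so that there
   is exactly one 0-permutation; this is only relevant to the one-vertex tree,
   whose global indegree sequence is the empty partition. *)
Definition kperms_last (r : 'I_n) (k : nat) : {set k.-tuple 'I_n} :=
  [set s : k.-tuple 'I_n | uniq s && (last r s == r)].

Lemma acyclicP E :
  reflect (forall c : seq 'I_n, 2 < size c -> ~ ucycle (adj E) c) (acyclic E).
Proof.
apply: (iffP forallP) => [acE c c2 cyc | acE k].
  have/andP[_ Uc] := cyc.
  have sc : size c < n.+1.
    by rewrite ltnS -[X in _ <= X](card_ord n) -(card_uniqP Uc) max_card.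
  have := forallP (acE (Ordinal sc)) (in_tuple c).
  by move/implyP/(_ c2)/negP=> /(_ cyc).
apply/forallP=> c; apply/implyP=> k2; apply/negP.
by apply: acE; rewrite size_tuple.
Qed.

Lemma towards_rootP (r : 'I_n) E (u v : 'I_n) :
  reflect (exists p : seq 'I_n,
             [/\ path (adj E) u (v :: p), uniq (u :: v :: p) & last v p = r])
          (towards_root r E u v).
Proof.
apply: (iffP and3P) => [[uv neq /connectP[p0 p0P ->]] | [p [pP up <-]]].
  case/shortenP: p0P => p pP up _.
  have [pA pu] : path (adj E) v p /\ u \notin p.
    elim: p v {uv neq up} pP => //= y p IH v /andP[/and3P[vy _ yu]].
    case/IH=> -> up; split; first by rewrite vy.
    by rewrite inE negb_or eq_sym yu.
  exists p; split=> //=; first by rewrite uv.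
  by rewrite inE negb_or neq pu.
move: pP up; rewrite /= inE negb_or => /andP[uv pA] /andP[/andP[neq pu] _].
split=> //; apply/connectP; exists p => //.
elim: p v {uv} pA pu neq => //= y p IH v /andP[vy pA].
rewrite inE negb_or => /andP[uy up] uv.
by rewrite vy (eq_sym v) uv (eq_sym y) uy /= IH.
Qed.

Lemma count_global_indegree_seq (r : 'I_n) E (i : nat) : 0 < i ->
  count_mem i (global_indegree_seq r E)
    = #|[set v | global_indegree r E v == i]|.
Proof.
move=> i0; rewrite /global_indegree_seq count_sort count_filter.
rewrite (eq_count (a2 := pred1 i)); last first.
  by move=> d /=; case: eqP => //= ->; rewrite i0.
rewrite /image_mem count_map -size_filter cardsE cardE /enum_mem -filter_predI.
by congr size; apply: eq_filter => v; rewrite /= andbT.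
Qed.

End Trees.

Section SetPartitions.
Variable X : finType.

Definition setpart_type (P : {set {set X}}) : seq nat :=
  sort leq [seq #|B| | B : {set X} in P].

Definition setparts (l : seq nat) : {set {set {set X}}} :=
  [set P | partition P [set: X] && (setpart_type P == l)].

Lemma count_setpart_type (P : {set {set X}}) (i : nat) :
  count_mem i (setpart_type P) = #|[set B in P | #|B| == i]|.
Proof.
rewrite /setpart_type count_sort /image_mem count_map -size_filter.
rewrite cardsE cardE /enum_mem -filter_predI; congr (size _).
by apply: eq_filter => B /=; rewrite andbC.
Qed.

End SetPartitions.

(* Main.v *)
(* Both sides are equinumerous with the words of length n - 1 over [n] that end
   in r and whose nonzero letter multiplicities form l.

   A tree rooted at r amounts to its parent function, and the global indegree
   of v is the number of times v is a value of it off r. For prescribed child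
   counts d, removing a fixed leaf and removing the first letter of a word give
   the same recurrence, so there are as many trees with child counts d as words
   ending in r in which each v occurs d v times.

   A word of length n - 1 is a set partition of its positions (equal letters)
   together with an injective naming of the blocks by letters; ordering the
   blocks by last occurrence makes the naming a permutation whose last entry is
   the last letter of the word. *)
Require Import Defs.
From mathcomp Require Import all_boot.
Set Implicit Arguments.
Unset Strict Implicit.
Unset Printing Implicit Defensive.

Lemma bij_of_card (A B : finType) :
  #|A| = #|B| -> exists f : A -> B, bijective f.
Proof.
move=> eqAB; exists (fun x => enum_val (cast_ord eqAB (enum_rank x))).
exists (fun y => enum_val (cast_ord (esym eqAB) (enum_rank y))) => x.
  by rewrite enum_valK cast_ordK enum_rankK.
by rewrite enum_valK cast_ordKV enum_rankK.
Qed.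

Lemma eq_card_fibers (A B : finType) (D : eqType) (S : {set A}) (R : {set B})
    (f : A -> D) (g : B -> D) :
    (forall d, #|[set x in S | f x == d]| = #|[set y in R | g y == d]|) ->
  forall Q : pred D, #|[set x in S | Q (f x)]| = #|[set y in R | Q (g y)]|.
Proof.
have cardE' (C : finType) (U : {set C}) (h : C -> D) (Q : pred D) :
    #|[set x in U | Q (h x)]| = count Q [seq h x | x in U].
  rewrite count_map -size_filter cardE /enum_mem -filter_predI.
  by congr size; apply: eq_filter => x; rewrite !inE andbC.
move=> eq_fg Q; rewrite !cardE'; apply/permP/allP=> d _ /=.
by rewrite -!cardE' eq_fg.
Qed.

(** * Arborescences and words with prescribed multiplicities *)

Section Arborescences.
Variables (T : finType) (r : T).
Implicit Types (p q : {ffun T -> T}) (V : {set T}) (d : T -> nat).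

(* An arborescence on V rooted at r is encoded by its parent function,
   extended by the value r at r and outside of V. *)
Definition arborescences V : {set {ffun T -> T}} :=
  [set p : {ffun T -> T} | [forall v, fconnect p v r
            && (if v \in V :\ r then p v \in V else p v == r)]].

Definition children V p (v : T) : nat := #|[set u in V :\ r | p u == v]|.

Lemma arborescencesP V p :
  reflect [/\ forall v, fconnect p v r,
              forall v, v \in V :\ r -> p v \in V
            & forall v, v \notin V :\ r -> p v = r]
          (p \in arborescences V).
Proof.
rewrite inE; apply: (iffP forallP) => [pA | [pr pV pN] v].
  split=> v; have /andP[pr] := pA v => // + vV; first by rewrite vV.
  by rewrite (negPf vV) => /eqP.
by rewrite pr /=; case: ifPn => [/pV | /pN ->].
Qed.

Lemma fconnect_depth p : (forall v, fconnect p v r) ->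
  exists h : T -> nat, forall v, v != r -> h v = (h (p v)).+1.
Proof.
move=> pr; have ex v : exists k, iter k p v == r.
  by exists (findex p v r); rewrite iter_findex.
exists (fun v => ex_minn (ex v)) => v vr.
case: ex_minnP => -[|k]; first by rewrite (negPf vr).
rewrite iterSr => vk min_k; case: ex_minnP => j vj min_j.
congr _.+1; apply/eqP; rewrite eqn_leq min_j // andbT.
by have := min_k j.+1; rewrite iterSr => /(_ vj).
Qed.

Lemma depth_fconnect p (h : T -> nat) :
    (forall v, v != r -> h (p v) < h v) ->
  forall v, fconnect p v r.
Proof.
move=> hp v; have [k] := ubnP (h v); elim: k v => // k IH v hk.
have [->|vr] := eqVneq v r; first exact: connect0.
apply: connect_trans (fconnect1 p v) (IH _ _).
exact: leq_trans (hp v vr) _.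
Qed.

Lemma fconnect_neq p v : (forall v, fconnect p v r) -> v != r -> p v != v.
Proof.
move=> /fconnect_depth[h hp] vr; apply/eqP=> pv.
by have := hp v vr; rewrite pv; elim: (h v) => // k IH [].
Qed.

Definition redirect p (a b : T) : {ffun T -> T} :=
  [ffun v => if v == a then b else p v].

Lemma redirect_fconnect p a b :
    a != r -> b != a -> (forall v, v != a -> p v != a) ->
    (forall v, fconnect p v r) ->
  forall v, fconnect (redirect p a b) v r.
Proof.
move=> ar ba pNa /fconnect_depth[h hp].
apply: (@depth_fconnect _ (fun v => if v == a then (h b).+1 else h v)) => v vr.
rewrite ffunE; case: (eqVneq v a) => [_|va]; first by rewrite (negPf ba).
by rewrite (negPf (pNa v va)) (hp v vr).
Qed.

Lemma children_redirect V p a b v : a \in V :\ r ->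
  children V (redirect p a b) v = (b == v) + children (V :\ a) p v.
Proof.
move=> aV; rewrite /children (cardsD1 a) !inE ffunE eqxx -in_setD1 aV /=.
congr (_ + _); apply: eq_card => u; rewrite !inE ffunE.
by case: eqVneq => //= _; rewrite andbF.
Qed.

Lemma children_gt0 V p a : a \in V :\ r -> 0 < children V p (p a).
Proof. by move=> aV; apply/card_gt0P; exists a; rewrite inE aV /=. Qed.

Lemma sum_children V p : \sum_v children V p v = #|V :\ r|.
Proof.
rewrite -sum1_card [RHS](partition_big p xpredT) //=; apply: eq_bigr => v _.
by rewrite sum1dep_card.
Qed.

Lemma children_root_gt0 V p :
  p \in arborescences V -> 0 < #|V :\ r| -> 0 < children V p r.
Proof.
move=> /arborescencesP[/fconnect_depth[h hp] pV pN] /card_gt0P[v0 v0V].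
have [v vV min_v] := arg_minnP h v0V.
apply/card_gt0P; exists v; rewrite inE; apply/andP; split=> //.
have [//|pvr] := eqVneq (p v) r.
have pvV : p v \in V :\ r by rewrite in_setD1 pvr pV.
have := min_v _ pvV; by rewrite (hp v) ?ltnn //; case/setD1P: vV.
Qed.

Definition arborescences_with V d : {set {ffun T -> T}} :=
  [set p in arborescences V | [forall v, children V p v == d v]].

Lemma arborescences_withP V d p :
  reflect (p \in arborescences V /\ children V p =1 d)
          (p \in arborescences_with V d).
Proof.
rewrite [p \in arborescences_with V d]in_set; apply: (iffP andP) => -[-> H]; split=> //.
  by move=> v; apply/eqP/(forallP H).
by apply/forallP=> v; rewrite H.
Qed.

Definition decr d b : T -> nat := fun v => d v - (b == v).

Lemma card_arborescences_leaf V d a b :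
    a \in V :\ r -> d a = 0 -> (forall v, v \notin V -> d v = 0) ->
  #|[set p in arborescences_with V d | p a == b]| =
    if 0 < d b then #|arborescences_with (V :\ a) (decr d b)| else 0.
Proof.
move=> aV da0 dV; have /setD1P[ar aV'] := aV.
have [db0|db] := posnP.
  apply: eq_card0 => p; rewrite in_set.
  apply/negP=> /andP[/arborescences_withP[_ pd] /eqP pa].
  by have := children_gt0 p aV; rewrite pa pd db0.
have bV : b \in V by apply: contraTT db => /dV->.
have ba : b != a by apply: contraTneq db => ->; rewrite da0.
set D := arborescences_with (V :\ a) _.
rewrite -(card_in_imset (f := fun q => redirect q a b) (D := D)); last first.
  move=> p q /arborescences_withP[/arborescencesP[_ _ pN] _].
  move=> /arborescences_withP[/arborescencesP[_ _ qN] _] /ffunP eqpq.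
  apply/ffunP=> v; have := eqpq v; rewrite !ffunE; case: eqP => // -> _.
  by rewrite pN ?qN // !inE eqxx ?andbF.
apply: eq_card => p; rewrite in_set; apply/andP/imsetP => [[]|[q]].
  move=> /arborescences_withP[pA pd] /eqP pa.
  have /arborescencesP[pr pV pN] := pA.
  have pNa v : p v != a.
    apply/eqP=> pva; have [vV|/pN] := boolP (v \in V :\ r).
      by have := children_gt0 p vV; rewrite pva pd da0.
    by rewrite pva => /eqP; rewrite (negPf ar).
  have redK : p = redirect (redirect p a r) a b.
    by apply/ffunP=> v; rewrite !ffunE; case: eqP => // ->.
  exists (redirect p a r) => //; apply/arborescences_withP; split.
    apply/arborescencesP; split.
    - by apply: redirect_fconnect => //; rewrite eq_sym.
    - move=> v; rewrite !inE ffunE => /and3P[vr va vV].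
      by rewrite (negPf va) pNa pV // !inE vr.
    - move=> v; rewrite !inE ffunE; case: (eqVneq v a) => //= _ H.
      by apply: pN; rewrite !inE.
  move=> v; rewrite /decr -pd.
  by have := children_redirect (redirect p a r) b v aV; rewrite -redK => ->; rewrite addKn.
move=> /arborescences_withP[/arborescencesP[qr qV qN] qd] ->.
split; last by rewrite ffunE eqxx.
apply/arborescences_withP; split; last first.
  move=> v; rewrite children_redirect // qd /decr.
  by case: (eqVneq b v) => [<-|]; rewrite ?subn0 // subnKC.
apply/arborescencesP; split.
- apply: redirect_fconnect => // v _.
  have [/qV|/qN->] := boolP (v \in (V :\ a) :\ r); last by rewrite eq_sym.
  by case/setD1P.
- move=> v vV; rewrite ffunE; case: eqP => // /eqP va.
  have /qV : v \in (V :\ a) :\ r by move: vV; rewrite !inE va.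
  by case/setD1P.
- move=> v vV; rewrite ffunE; case: eqP => [va|_]; first by rewrite va aV in vV.
  by apply: qN; apply: contra vV; rewrite !inE => /and3P[-> _ ->].
Qed.

Definition words_with m d : {set m.-tuple T} :=
  [set s : m.-tuple T | (last r s == r) && [forall v, count_mem v s == d v]].

Lemma words_withP m d (s : m.-tuple T) :
  reflect (last r s = r /\ forall v, count_mem v s = d v)
          (s \in words_with m d).
Proof.
rewrite in_set; apply: (iffP andP) => -[] => [/eqP -> /forallP H|-> H]; split=> //.
  by move=> v; apply/eqP.
by apply/forallP=> v; rewrite H.
Qed.

Lemma card_words_head m d b :
    (0 < m) || [forall v, (v != r) ==> (d v == 0)] ->
  #|[set s in words_with m.+1 d | thead s == b]| =
    if 0 < d b then #|words_with m (decr d b)| else 0.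
Proof.
move=> md; have [db0|db] := posnP.
  apply: eq_card0 => s; rewrite in_set; apply/negP=> /andP[/words_withP[_ sd]].
  by have := sd b; case/tupleP: s {sd} => x s; rewrite theadE db0 /=; case: eqP.
have br : m = 0 -> b = r.
  move=> m0; move: md; rewrite m0 /= => /forallP/(_ b).
  by case: eqVneq => //= _ /eqP db0; rewrite db0 in db.
set D := words_with m _.
rewrite -(card_imset D (f := fun s : m.-tuple T => [tuple of b :: s])); last first.
  by move=> s t /(congr1 val)[] /val_inj.
have last_cons (s : m.-tuple T) : (last b s == r) = (last r s == r).
  case: (posnP m) => [m0|m0]; first by rewrite (br m0).
  by case: m s m0 {md br D} => // m s _; case/tupleP: s.
apply: eq_card => s; rewrite in_set; apply/andP/imsetP => [[]|[t]].
  case/tupleP: s => x s; rewrite theadE => /words_withP[/= /eqP sr sd] /eqP xb.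
  rewrite xb last_cons in sr sd *.
  exists s => //; apply/words_withP; split; first exact/eqP.
  by move=> v; rewrite /decr -sd addKn.
move=> /words_withP[tr td] ->; rewrite theadE; split=> //.
apply/words_withP; split=> /= [|v]; first by apply/eqP; rewrite last_cons tr.
by rewrite td /decr; case: (eqVneq b v) => [<-|]; rewrite ?subn0 // subnKC.
Qed.

(* Removing a fixed leaf [a] from a tree and removing the first letter from a
   word satisfy the same recurrence: the removed letter is the parent of a. *)
Lemma card_arborescences_with m V d :
    r \in V -> #|V| = m.+1 -> (forall v, v \notin V -> d v = 0) ->
  #|arborescences_with V d| = #|words_with m d|.
Proof.
elim: m V d => [|m IH] V d rV cV dV.
  have VrN v : v \notin V :\ r.
    have : #|V :\ r| == 0 by have := cardsD1 r V; rewrite rV cV add1n => -[<-].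
    by rewrite cards_eq0 => /eqP->; rewrite inE.
  have [/forallP d0|dN] := boolP [forall v, 0 == d v].
    rewrite (_ : arborescences_with V d = [set [ffun => r]]); last first.
      apply/setP=> p; rewrite in_set1; apply/arborescences_withP/eqP => [[]|->].
        by move=> /arborescencesP[_ _ pN] _; apply/ffunP=> v; rewrite ffunE pN.
      split.
        apply/arborescencesP; split=> v.
        - apply: (@depth_fconnect _ (fun v => (v != r) : nat)) => u ->.
          by rewrite ffunE eqxx.
        - by rewrite (negPf (VrN v)).
        - by rewrite ffunE.
      move=> v; apply: etrans (eqP (d0 v)); apply: eq_card0 => u.
      by rewrite inE (negPf (VrN u)).
    rewrite (_ : words_with 0 d = [set [tuple]]) ?cards1 //.
    apply/setP=> s; rewrite in_set1 [s]tuple0 eqxx; apply/words_withP; split=> // v.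
    exact: (eqP (d0 v)).
  rewrite !eq_card0 // => [s|p]; apply/negP.
    move=> /words_withP[_ sd]; case/forallP: dN => v.
    by rewrite -sd [s]tuple0.
  move=> /arborescences_withP[_ pd]; case/forallP: dN => v.
  rewrite -pd eq_sym; apply/eqP; apply: eq_card0 => u.
  by rewrite inE (negPf (VrN u)).
have cVr : #|V :\ r| = m.+1 by have := cardsD1 r V; rewrite rV cV add1n => -[<-].
have [/existsP[a /andP[aV /eqP da]]|noleaf] :=
    boolP [exists a, (a \in V :\ r) && (d a == 0)].
  have /setD1P[ar aV'] := aV.
  have cVa : #|V :\ a| = m.+1 by have := cardsD1 a V; rewrite aV' cV add1n => -[<-].
  rewrite -!sum1_card (partition_big (fun p => p a) xpredT) //=.
  rewrite [RHS](partition_big (fun s => thead s) xpredT) //=.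
  apply: eq_bigr => b _; rewrite !sum1dep_card.
  rewrite card_arborescences_leaf // card_words_head; last first.
    case: m {IH cV} cVr cVa => //= cVr _; apply/forallP=> v; apply/implyP=> vr.
    have [->|va] := eqVneq v a; first by rewrite da.
    rewrite dV //; move: vr; apply: contra => vV; apply/eqP.
    have := cardsD1 a (V :\ r); rewrite aV cVr add1n => -[] /esym/eqP.
    rewrite cards_eq0 => /eqP/setP/(_ v); rewrite !inE va vV andbT /=.
    by move/negbFE/eqP.
  case: ifP => // db; apply: IH => // [|v].
    by rewrite !inE eq_sym ar.
  by rewrite !inE negb_and negbK => /orP[/eqP->|/dV]; rewrite /decr ?da // => ->.
have dr0 : \sum_v d v = m.+1 -> d r = 0.
  rewrite (bigD1 r) //= => sd; suff: m.+1 <= \sum_(v | v != r) d v.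
    by rewrite -sd -[X in _ <= X]add0n leq_add2r leqn0 => /eqP.
  rewrite -cVr -sum1_card [X in _ <= X]big_mkcond [X in X <= _]big_mkcond /=.
  apply: leq_sum => v _; case: ifP => // vV; have /setD1P[-> _] := vV.
  by rewrite lt0n; apply: contra noleaf => dv; apply/existsP; exists v; rewrite vV.
rewrite !eq_card0 // => [s|p]; apply/negP.
  move=> /words_withP[sr sd]; have: 0 < count_mem r s.
    rewrite -has_count has_pred1 -{1}sr.
    by case/tupleP: s {sr sd} => x s /=; apply: mem_last.
  rewrite sd dr0 // -(size_tuple s) -sum1_size.
  rewrite [RHS](partition_big id xpredT) //=; apply: eq_bigr => v _.
  by rewrite sum1_count -sd; apply: eq_count.
move=> /arborescences_withP[pA pd].
have := children_root_gt0 pA; rewrite cVr pd dr0 => [/(_ isT)//|].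
by rewrite -cVr -(sum_children V p); apply: eq_bigr => v _; rewrite pd.
Qed.

End Arborescences.

(** * Trees as parent functions *)

Section RootedTrees.
Variables (n : nat) (r : 'I_n).
Implicit Types (E : {set {set 'I_n}}) (p : {ffun 'I_n -> 'I_n}).

Lemma adj_sym E : symmetric (adj E).
Proof. by move=> x y; rewrite /adj /= setUC. Qed.

Lemma towards_root_inj E u v w :
  acyclic E -> towards_root r E u v -> towards_root r E u w -> v = w.
Proof.
move=> acE /and3P[uv neq_uv vr] /and3P[uw neq_uw wr].
apply/eqP/negPn/negP=> neq_vw; set e := [rel x y | _] in vr wr.
have e_sym : connect_sym e.
  apply: sym_connect_sym => x y /=.
  by rewrite adj_sym; case: (adj E y x) => //=; rewrite andbC.
have /connectP[q0 eq0 w_last] : connect e v w.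
  by apply: connect_trans vr _; rewrite e_sym.
case/shortenP: eq0 w_last => q eq Uq _ w_last.
have [Eq uNq] : path (adj E) v q /\ u \notin q.
  elim: q v {uv neq_uv vr neq_vw q0 w_last Uq} eq => //= y q IH v.
  case/andP=> /and3P[vy _ yu] /IH[-> uq]; split; first by rewrite vy.
  by rewrite inE negb_or eq_sym yu.
apply: (elimT (acyclicP E) acE [:: u, v & q]).
  by case: q w_last neq_vw {eq Uq Eq uNq} => //= ->; rewrite eqxx.
rewrite /ucycle /ucycleb /= rcons_path uv Eq -w_last adj_sym uw /=.
by move: Uq => /= ->; rewrite inE negb_or neq_uv uNq.
Qed.

Lemma towards_root_neq E u v : towards_root r E u v -> u != r.
Proof.
move=> /and3P[_ uv /connectP[q]]; elim: q v uv => [|y q IH] v uv /=.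
  by move=> _ ->.
by move=> /andP[/and3P[_ _ yu] /IH]; apply; rewrite eq_sym.
Qed.

Definition edges_of_parents p : {set {set 'I_n}} :=
  [set [set v; p v] | v in [set~ r]].

Lemma adj_edges_of_parents p x y :
  reflect (x != r /\ y = p x \/ y != r /\ x = p y)
          (adj (edges_of_parents p) x y).
Proof.
apply: (iffP imsetP) => [[v]|[[xr ->]|[yr ->]]]; last 2 first.
- by exists x; rewrite ?inE.
- by exists y; rewrite ?inE // setUC.
rewrite !inE => vr eqxy.
have vE : v \in [set x; y] by rewrite eqxy set21.
have pvE : p v \in [set x; y] by rewrite eqxy set22.
have xE : x \in [set v; p v] by rewrite -eqxy set21.
have yE : y \in [set v; p v] by rewrite -eqxy set22.
rewrite !inE in vE pvE xE yE.
have [xv|xv] := eqVneq x v; last first.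
  by right; move: vE xE; rewrite eq_sym (negPf xv) /= => /eqP <- /eqP.
left; rewrite xv; split=> //; apply/eqP; case/orP: yE => // /eqP yv.
by move: pvE; rewrite xv yv orbb eq_sym.
Qed.

Lemma edges_of_parents_simple p :
  (forall v, v != r -> p v != v) -> simple_graph (edges_of_parents p).
Proof.
move=> pN; apply/forall_inP=> e /imsetP[v]; rewrite !inE => /pN pv ->.
by rewrite cards2 (eq_sym v) pv.
Qed.

Lemma edges_of_parents_tree p :
  p \in arborescences r [set: 'I_n] -> is_tree (edges_of_parents p).
Proof.
move=> /arborescencesP[pr _ _]; have [h hp] := fconnect_depth pr.
have symE : connect_sym (adj (edges_of_parents p)).
  exact/sym_connect_sym/adj_sym.
have conr v : connect (adj (edges_of_parents p)) v r.
  have [k] := ubnP (h v); elim: k v => // k IH v hk.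
  have [->|vr] := eqVneq v r; first exact: connect0.
  apply: (@connect_trans _ _ (p v)).
    by apply/connect1/adj_edges_of_parents; left.
  by apply: IH; rewrite -ltnS -(hp v vr).
apply/and3P; split.
- by apply: edges_of_parents_simple => v; apply: fconnect_neq.
- apply/forallP=> x; apply/forallP=> y.
  by apply: connect_trans (conr x) _; rewrite symE.
apply/acyclicP=> c c2 /andP[cyc Uc].
have [x0 x0c] : exists x, x \in c.
  by case: c c2 {cyc Uc} => // x c; exists x; rewrite mem_head.
have [u uc max_u] := arg_maxnP h x0c.
have uE x : x \in c -> adj (edges_of_parents p) u x -> x = p u.
  move=> xc /adj_edges_of_parents[[] //|[xr ux]].
  by have : h x <= h u := max_u x xc; rewrite (hp x xr) -ux ltnn.
case/rot_to: uc => i c' rot_c.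
move: cyc Uc c2; rewrite -(rot_cycle i) -(rot_uniq i) -(size_rot i) rot_c.
have {uE}: forall x, x \in c' -> adj (edges_of_parents p) u x -> x = p u.
  by move=> x xc'; apply: uE; rewrite -(mem_rot i) rot_c inE xc' orbT.
case: c' {rot_c} => [|x c'] // uE; case/lastP: c' uE => // c' y uE.
rewrite /= rcons_path last_rcons => /and3P[ux _ yu] /and3P[_ xc' _] _.
have xE := uE x (mem_head _ _) ux.
case/negP: xc'; rewrite mem_rcons inE xE -(uE y) ?eqxx //.
  by rewrite inE mem_rcons mem_head orbT.
by rewrite adj_sym.
Qed.

Lemma towards_root_edges p u v : p \in arborescences r [set: 'I_n] ->
  towards_root r (edges_of_parents p) u v = (u != r) && (v == p u).
Proof.
move=> pA; have /and3P[_ _ acE] := edges_of_parents_tree pA.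
have /arborescencesP[pr _ _] := pA; have [h hp] := fconnect_depth pr.
suff up w : w != r -> towards_root r (edges_of_parents p) w (p w).
  apply/idP/andP => [uv|[/up uv /eqP->] //].
  have ur := towards_root_neq uv; split=> //; apply/eqP.
  exact: (towards_root_inj acE uv (up u ur)).
move=> wr; apply/and3P; split.
- by apply/adj_edges_of_parents; left.
- by rewrite eq_sym (fconnect_neq pr).
have: h (p w) < h w by rewrite (hp w wr).
have [k] := ubnP (h (p w)); elim: k (p w) => // k IH x xk xw.
have [->|xr] := eqVneq x r; first exact: connect0.
have hx := hp x xr; have pxw : h (p x) < h w by rewrite -hx ltnW.
apply: (@connect_trans _ _ (p x)); last first.
  by apply: IH => //; rewrite -hx.
apply: connect1; apply/and3P; split.
- by apply/adj_edges_of_parents; left.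
- by apply: contraTneq xw => ->; rewrite ltnn.
- by apply: contraTneq pxw => ->; rewrite ltnn.
Qed.

Lemma edges_of_parents_inj :
  {in arborescences r [set: 'I_n] &, injective edges_of_parents}.
Proof.
move=> p q pA qA eqE; apply/ffunP=> v.
have [->|vr] := eqVneq v r.
  have /arborescencesP[_ _ pN] := pA; have /arborescencesP[_ _ qN] := qA.
  by rewrite pN ?qN // !inE eqxx.
have := towards_root_edges v (p v) pA.
by rewrite eqE towards_root_edges // vr eqxx => /eqP.
Qed.

Lemma towards_root_exists E u :
  connected_graph E -> u != r -> exists v, towards_root r E u v.
Proof.
move=> /forallP/(_ u)/forallP/(_ r)/connectP[q0 Eq0 r_last] ur.
case/shortenP: Eq0 r_last => -[|v q] Eq Uq _ r_last.
  by rewrite r_last eqxx in ur.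
by exists v; apply/towards_rootP; exists q.
Qed.

Lemma tree_edges_of_parents E : is_tree E ->
  exists2 p, p \in arborescences r [set: 'I_n] & E = edges_of_parents p.
Proof.
move=> /and3P[simE conE acE].
have [p pP] : {p : {ffun 'I_n -> 'I_n} |
    forall u, if u == r then p u = r else towards_root r E u (p u)}.
  exists [ffun u => if u == r then r else odflt r [pick v | towards_root r E u v]].
  move=> u; rewrite ffunE; case: eqVneq => // ur; case: pickP => //= no.
  by have [v] := towards_root_exists conE ur; rewrite no.
have up u : u != r -> towards_root r E u (p u).
  by move=> ur; have := pP u; rewrite (negPf ur).
have pE u v : towards_root r E u v -> p u = v.
  move=> uv; apply: (towards_root_inj acE _ uv).
  exact/up/(towards_root_neq uv).
have fcon q u : path (adj E) u q -> uniq (u :: q) -> last u q = r ->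
    fconnect p u r.
  elim: q u => [|v q IH] u; first by move=> _ _ /= ->; apply: connect0.
  move=> Euq Uuq r_last; have puv : p u = v.
    by apply: pE; apply/towards_rootP; exists q.
  case/andP: Euq Uuq => _ Evq /andP[_ Uvq].
  by apply: connect_trans (fconnect1 p u) _; rewrite puv; apply: IH.
exists p.
  apply/arborescencesP; split=> v; last 2 first.
  - by rewrite inE.
  - by rewrite !inE andbT negbK => /eqP->; have := pP r; rewrite eqxx.
  have /connectP[q0 Eq0 r_last] := forallP (forallP conE v) r.
  by case/shortenP: Eq0 r_last => q Eq Uq _ /esym; apply: fcon.
apply/setP=> e; apply/idP/imsetP => [eE|[v]]; last first.
  by rewrite !inE => /up/and3P[vE _ _] ->.
have /cards2P[x [y [xy eE2]]] := forall_inP simE e eE.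
have Exy : adj E x y by move: eE; rewrite eE2.
suff: towards_root r E x y \/ towards_root r E y x.
  case=> H; [exists x | exists y].
  - by rewrite !inE (towards_root_neq H).
  - by rewrite eE2 (pE _ _ H).
  - by rewrite !inE (towards_root_neq H).
  - by rewrite eE2 (pE _ _ H) setUC.
have /connectP[q0 Eq0 r_last] := forallP (forallP conE y) r.
case/shortenP: Eq0 r_last => q Eq Uq _ r_last.
have [xq|xq] := boolP (x \in q); [right|left].
  case/splitPr: xq Eq Uq r_last => q1 q2.
  rewrite cat_path last_cat /= mem_cat negb_or cat_uniq.
  move=> /and3P[_ _ xq2] /andP[/andP[_ yq2] /and3P[_ _ Uq2]] r_last.
  apply/towards_rootP; exists q2; split=> //; last by rewrite /= yq2.
  by rewrite /= adj_sym Exy.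
apply/towards_rootP; exists q; split=> //; first by rewrite /= Exy.
by rewrite cons_uniq inE negb_or xy xq.
Qed.

Lemma global_indegree_edges p : p \in arborescences r [set: 'I_n] ->
  global_indegree r (edges_of_parents p) =1 children r [set: 'I_n] p.
Proof.
move=> pA v; apply: eq_card => u.
by rewrite !inE towards_root_edges // andbT (eq_sym v).
Qed.

Lemma rooted_trees_edges l :
  rooted_trees r l = edges_of_parents @: [set p in arborescences r [set: 'I_n] |
    sort leq [seq d <- [seq children r [set: 'I_n] p v | v : 'I_n] | 0 < d] == l].
Proof.
have seqE p : p \in arborescences r [set: 'I_n] ->
    global_indegree_seq r (edges_of_parents p) =
    sort leq [seq d <- [seq children r [set: 'I_n] p v | v : 'I_n] | 0 < d].
  move=> pA; congr (sort _ (filter _ _)).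
  by apply: eq_map => v; apply: global_indegree_edges.
apply/setP=> E; rewrite in_set; apply/andP/imsetP => [[treeE]|[p]].
  have [p pA ->] := tree_edges_of_parents treeE; rewrite seqE // => pl.
  by exists p; rewrite // in_set pA.
rewrite in_set => /andP[pA pl] ->; split; last by rewrite seqE.
exact: edges_of_parents_tree.
Qed.

End RootedTrees.

(** * Words and labeled set partitions *)

Lemma last_undup (T : eqType) (x : T) s : last x (undup s) = last x s.
Proof.
elim: s x => //= y s IH x; case: ifP => //= ys; rewrite -IH.
by have: y \in undup s; [rewrite mem_undup | case: (undup s)].
Qed.

Lemma undup_map_inj_in (T U : eqType) (h : T -> U) s :
  {in s &, injective h} -> undup (map h s) = map h (undup s).
Proof.
elim: s => //= x s IH inj_h.
have /IH -> : {in s &, injective h}.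
  by move=> y z ys zs; apply: inj_h; rewrite inE ?ys ?zs orbT.
suff -> : (h x \in map h s) = (x \in s) by case: ifP.
apply/mapP/idP => [[y ys hxy]|xs]; last by exists x.
by rewrite (inj_h x y) // inE ?eqxx ?ys ?orbT.
Qed.

Section Fibers.
Variables (X T : finType).
Implicit Types (f : {ffun X -> T}) (P : {set {set X}}) (l : seq nat).

Definition content_type (s : seq T) : seq nat :=
  sort leq [seq d <- [seq count_mem v s | v : T] | 0 < d].

Lemma size_content_type s : size (content_type s) = size (undup s).
Proof.
rewrite size_sort size_filter count_map -size_filter.
rewrite -(card_uniqP (undup_uniq s)) cardE /enum_mem -filter_predI.
congr size; apply: eq_filter => v.
by rewrite /= andbT -has_count has_pred1 -mem_undup.
Qed.

Lemma setpart_type_fibers f :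
  setpart_type (preim_partition f [set: X]) = content_type (codom f).
Proof.
pose fib v := f @^-1: [set v].
have cardfib v : count_mem v (codom f) = #|fib v|.
  rewrite count_map -size_filter cardE /enum_mem -filter_predI.
  by congr size; apply: eq_filter => x; rewrite !inE andbT.
rewrite /setpart_type /content_type /image_mem filter_map.
rewrite (eq_map (g := fun v => #|fib v|)) //.
rewrite [X in _ = sort _ X](map_comp (fun B : {set X} => #|B|) fib).
apply/(perm_sortP leq_total leq_trans anti_leq)/perm_map/uniq_perm.
- exact: enum_uniq.
- rewrite map_inj_in_uniq; first exact/filter_uniq/enum_uniq.
  move=> u v.
  rewrite mem_filter /= cardfib => /andP[/card_gt0P[x xu] _] _ uv.
  by move: xu (xu); rewrite {2}uv !inE => /eqP <- /eqP.
move=> B; rewrite mem_enum; apply/imsetP/mapP => [[x _ ->]|[v]].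
  exists (f x).
    rewrite mem_filter mem_enum andbT /= cardfib.
    by apply/card_gt0P; exists x; rewrite !inE.
  by apply/setP=> y; rewrite !inE eq_sym.
rewrite mem_filter /= cardfib => /andP[/card_gt0P[x]].
rewrite !inE => /eqP <- _ ->; exists x => //.
by apply/setP=> y; rewrite !inE eq_sym.
Qed.

Lemma eq_preim_partition (A B : eqType) (f : X -> A) (g : X -> B) (D : {set X}) :
    (forall x y, (f x == f y) = (g x == g y)) ->
  preim_partition f D = preim_partition g D.
Proof.
move=> fg; apply: eq_imset => x; apply/setP=> y.
by rewrite !inE fg.
Qed.

Definition blocks P : seq {set X} := undup (map (pblock P) (enum X)).

Lemma mem_blocks P : partition P [set: X] -> blocks P =i P.
Proof.
move=> /and3P[/eqP coverP tI P0] B; rewrite mem_undup.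
apply/mapP/idP => [[x _ ->]|BP]; first by rewrite pblock_mem // coverP.
have /set0Pn[x xB] : B != set0 by apply: contraNneq P0 => <-.
by exists x; rewrite ?mem_enum // (def_pblock tI BP xB).
Qed.

Lemma size_blocks P : partition P [set: X] -> size (blocks P) = #|P|.
Proof.
move=> partP; rewrite -(card_uniqP (undup_uniq _)).
exact/eq_card/mem_blocks.
Qed.

Lemma size_setpart_type P : size (setpart_type P) = #|P|.
Proof. by rewrite size_sort size_map -cardE. Qed.

Definition label_blocks (t0 : T) P (s : seq T) : {ffun X -> T} :=
  [ffun x => nth t0 s (index (pblock P x) (blocks P))].

Section Label.
Variables (t0 : T) (P : {set {set X}}) (s : seq T).
Hypotheses (Us : uniq s) (sizes : size s = size (blocks P)).

Lemma label_blocks_eq x y :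
  (label_blocks t0 P s x == label_blocks t0 P s y) = (pblock P x == pblock P y).
Proof.
have inP z : pblock P z \in blocks P by rewrite mem_undup map_f ?mem_enum.
rewrite !ffunE nth_uniq ?sizes ?index_mem //.
by apply/eqP/eqP => [e|->] //; exact: (index_inj set0 _ _ e).
Qed.

Lemma undup_label_blocks : undup (codom (label_blocks t0 P s)) = s.
Proof.
pose h B := nth t0 s (index B (blocks P)).
have -> : codom (label_blocks t0 P s) = map h (map (pblock P) (enum X)).
  by rewrite -map_comp; apply: eq_map => x; rewrite ffunE.
rewrite undup_map_inj_in -/(blocks P) => [|A B].
  apply: (@eq_from_nth _ t0) => [|i]; rewrite size_map // => ib.
  by rewrite (nth_map set0) // /h index_uniq ?undup_uniq.
rewrite -!(mem_undup (map _ _)) -/(blocks P) => AP BP /eqP.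
by rewrite /h nth_uniq ?sizes ?index_mem // => /eqP e; exact: (index_inj set0 _ _ e).
Qed.

End Label.

(* [undup] keeps last occurrences, so [blocks] lists the fibers of f in the order
   in which [undup (codom f)] lists its values. *)
Lemma label_blocks_preim (t0 : T) f :
  label_blocks t0 (preim_partition f [set: X]) (undup (codom f)) = f.
Proof.
set P := preim_partition f _.
have /and3P[/eqP coverP tI _] : partition P [set: X] by apply: preim_partitionP.
have pblockE x y : (y \in pblock P x) = (f x == f y).
  rewrite pblock_equivalence_partition ?inE //.
  by split=> [//|/eqP ->].
pose h (B : {set X}) := odflt t0 (omap f [pick x in B]).
have hP x : h (pblock P x) = f x.
  rewrite /h; case: pickP => [y /=|/(_ x)]; first by rewrite pblockE => /eqP.
  by rewrite pblockE eqxx.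
have codomE : codom f = map h (map (pblock P) (enum X)).
  by rewrite -map_comp; apply: eq_map => x /=; rewrite hP.
have blocksE : undup (codom f) = map h (blocks P).
  rewrite codomE undup_map_inj_in // => _ _ /mapP[x _ ->] /mapP[y _ ->].
  rewrite !hP => fxy; apply/eqP; rewrite eq_pblock ?coverP ?inE //.
  by rewrite pblockE fxy.
apply/ffunP=> x; rewrite ffunE blocksE.
have xP : pblock P x \in blocks P by rewrite mem_undup map_f ?mem_enum.
by rewrite (nth_map set0) ?index_mem // nth_index.
Qed.

End Fibers.

Lemma card_words_content_type n (r : 'I_n) (X : finType) l :
  #|[set s : #|X|.-tuple 'I_n | (last r s == r) && (content_type s == l)]|
    = #|setparts X l| * #|kperms_last r (size l)|.
Proof.
set W := [set s | _].
pose word (u : {set {set X}} * (size l).-tuple 'I_n) :=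
  fgraph (label_blocks r u.1 u.2).
have sizel P : P \in setparts X l -> size l = size (blocks P).
  by rewrite inE => /andP[partP /eqP <-]; rewrite size_blocks ?size_setpart_type.
rewrite -cardsX -(card_in_imset (f := word)); last first.
  move=> [P s] [Q t]; rewrite !in_setX /=.
  move=> /andP[Pl]; rewrite inE => /andP[Us _] /andP[Ql].
  rewrite inE => /andP[Ut _] /(can_inj (@fgraphK _ _)) /= eqPQ.
  have sP : size s = size (blocks P) by rewrite size_tuple -sizel.
  have tQ : size t = size (blocks Q) by rewrite size_tuple -sizel.
  congr pair.
    have := Pl; have := Ql; rewrite !inE => /andP[partQ _] /andP[partP _].
    rewrite -(preim_partition_pblock partP) -(preim_partition_pblock partQ).
    apply: eq_preim_partition => x y.
    by rewrite -(label_blocks_eq r Us sP) eqPQ (label_blocks_eq r Ut tQ).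
  apply/val_inj; rewrite /= -(undup_label_blocks r Us sP) eqPQ.
  exact: undup_label_blocks.
apply: eq_card => w; rewrite in_set; apply/andP/imsetP => [[]|[[P s]]].
  rewrite -(FinfunK w) -codom_ffun; set f := Finfun w => /eqP fr /eqP fl.
  have partf := preim_partitionP f [set: X].
  have sizef : size (undup (codom f)) == size l.
    by rewrite -fl size_content_type.
  exists (preim_partition f [set: X], Tuple sizef).
    by rewrite in_setX !inE partf setpart_type_fibers fl undup_uniq last_undup fr !eqxx.
  by rewrite /word /= label_blocks_preim.
rewrite in_setX /= => /andP[Pl]; rewrite inE => /andP[Us /eqP sr] ->.
have sP : size s = size (blocks P) by rewrite size_tuple -sizel.
rewrite /word /= -last_undup undup_label_blocks // sr; split=> //.
have [partP Pl'] : partition P [set: X] /\ setpart_type P == l.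
  by apply/andP; rewrite inE in Pl.
rewrite -setpart_type_fibers (_ : preim_partition _ _ = P) //.
rewrite -[RHS](preim_partition_pblock partP).
by apply: eq_preim_partition => x y; apply: label_blocks_eq.
Qed.

Theorem theorem1p2 (n : nat) (hn : 1 <= n) (r : 'I_n) (l : seq nat)
    (hl : is_intpart n.-1 l) (X : finType) (hX : #|X| = n.-1) :
  exists f : {t | t \in rooted_trees r l} ->
             {P | P \in setparts X l} * {s | s \in kperms_last r (size l)},
    bijective f.
Proof.
apply: bij_of_card; rewrite card_prod !card_sig.
rewrite -[RHS]card_words_content_type rooted_trees_edges card_in_imset; last first.
  move=> p q; rewrite !in_set => /andP[pA _] /andP[qA _].
  by apply: edges_of_parents_inj; rewrite in_set.
pose Q (d : {ffun 'I_n -> nat}) :=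
  sort leq [seq k <- [seq d v | v : 'I_n] | 0 < k] == l.
pose childs p := [ffun v => children r [set: 'I_n] p v].
pose counts (s : #|X|.-tuple 'I_n) := [ffun v => count_mem v s].
have fibers d : #|[set p in arborescences r [set: 'I_n] | childs p == d]| =
    #|[set s in [set s : #|X|.-tuple 'I_n | last r s == r] | counts s == d]|.
  transitivity #|arborescences_with r [set: 'I_n] d|.
    apply: eq_card => p; rewrite !in_set; congr (_ && _).
    apply/eqP/forallP => [<- v|pd]; first by rewrite ffunE.
    by apply/ffunP=> v; rewrite ffunE; apply/eqP.
  rewrite (@card_arborescences_with _ _ #|X|) ?inE // => [||v]; last 2 first.
  - by rewrite cardsT card_ord hX prednK.
  - by rewrite inE.
  apply: eq_card => s; rewrite !in_set; congr (_ && _).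
  apply/forallP/eqP => [sd|<- v]; last by rewrite ffunE.
  by apply/ffunP=> v; rewrite ffunE; apply/eqP.
transitivity #|[set p in arborescences r [set: 'I_n] | Q (childs p)]|.
  apply: eq_card => p; rewrite !in_set; congr (_ && (sort _ (filter _ _) == _)).
  by apply: eq_map => v; rewrite ffunE.
rewrite (eq_card_fibers fibers Q).
apply: eq_card => s; rewrite !in_set; congr (_ && (sort _ (filter _ _) == _)).
by apply: eq_map => v; rewrite ffunE.
Qed.
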